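(* Let $f:\mathbb{R}^n\to\mathbb{R}^n$ and $\sigma:\mathbb{R}^n\to\mathbb{R}^{n\times m}$ be twice continuously differentiable with $f(0)=0$ and $\sigma(0)=0$. Let $A=Df(0)\in\mathbb{R}^{n\times n}$ and, for $k=1,\dots,m$, let $S_k=D\sigma_k(0)\in\mathbb{R}^{n\times n}$, where $\sigma_k(x)$ is the $k$-th column of $\sigma(x)$. Assume that $A$ is Hurwitz. Let $Q\in\mathbb{R}^{n\times n}$ be any symmetric positive definite matrix, and suppose there exists a symmetric positive definite matrix $P\in\mathbb{R}^{n\times n}$ satisfying $$PA+A^TP+\sum_{i=1}^m S_i^TPS_i=-Q.$$ Define $V_P(x)=x^TPx$, $h(x)=LV_P(x)$, and $M(x)=D^2h(x)+2Q$, where $D^2h(x)$ is the Hessian matrix of $h$ at $x$. Let $\varepsilon>0$ be sufficiently small that $r:=\lambda_{\min}(Q)-\varepsilon>0$. If there exists a constant $c>0$ such that $$\|M(x)\|_F\le 2r\quad\text{for all } x\in V_P^c:=\{x\in\mathbb{R}^n: V_P(x)\le c\},$$ then $$LV_P(x)<0\quad\text{for all } x\in V_P^c\setminus\{0\}.$$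
   Context: The differential operator $L$ associated with the stochastic differential equation $dX_t=f(X_t)\,dt+\sigma(X_t)\,dB_t$ acts on a $C^2$ function $V$ by $$LV(x)=V_x(x)f(x)+\tfrac12\operatorname{Tr}\big[\sigma^T(x)V_{xx}(x)\sigma(x)\big],$$ where $V_x$ is the gradient (row vector) and $V_{xx}$ the Hessian matrix of $V$. $\|\cdot\|_F$ denotes the Frobenius norm, and $\lambda_{\min}(Q)$ is the smallest eigenvalue of $Q$. A real square matrix is Hurwitz if all its eigenvalues have negative real part. *)

(* Defs.v *)
From HB Require Import structures.
From mathcomp Require Import all_boot all_order all_algebra.
From mathcomp Require Import boolp classical_sets reals topology normedtype derive.
From mathcomp Require Import complex.

Set Implicit Arguments.
Unset Strict Implicit.
Unset Printing Implicit Defensive.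

Import Order.TTheory GRing.Theory Num.Theory.
Import numFieldNormedType.Exports.

Local Open Scope classical_set_scope.
Local Open Scope ring_scope.

Section Calculus.
Context {R : realType} {n : nat}.

Definition partial (j : 'I_n) (g : 'cV[R]_n -> R) : 'cV[R]_n -> R :=
  fun x => 'D_(delta_mx j 0) g x.

Definition gradient (g : 'cV[R]_n -> R) (x : 'cV[R]_n) : 'rV[R]_n :=
  \row_j partial j g x.

Definition hessian (g : 'cV[R]_n -> R) (x : 'cV[R]_n) : 'M[R]_n :=
  \matrix_(i, j) partial i (partial j g) x.

(* Column-vector convention, so this is the transpose of the library's 'J,
   which acts on row vectors from the right. *)
Definition jacobian_mx {p : nat} (F : 'cV[R]_n -> 'cV[R]_p) (x : 'cV[R]_n) :
    'M[R]_(p, n) :=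
  \matrix_(i, j) partial j (fun y => F y i 0) x.

Definition C2 (g : 'cV[R]_n -> R) : Prop :=
  [/\ forall x, differentiable g x,
      forall x, differentiable (gradient g) x
    & continuous (hessian g)].

(* The case q = 1 covers vector-valued maps. *)
Definition C2_mx {p q : nat} (F : 'cV[R]_n -> 'M[R]_(p, q)) : Prop :=
  forall i j, C2 (fun x => F x i j).

(* The differential operator L of dX = f(X) dt + sigma(X) dB, applied to V. *)
Definition generator {m : nat} (f : 'cV[R]_n -> 'cV[R]_n)
    (sigma : 'cV[R]_n -> 'M[R]_(n, m)) (V : 'cV[R]_n -> R)
    (x : 'cV[R]_n) : R :=
  (gradient V x *m f x) 0 0
  + 2^-1 * \tr ((sigma x)^T *m hessian V x *m sigma x).

End Calculus.

Section Matrices.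
Context {R : realType}.

Definition quadratic_form {n : nat} (P : 'M[R]_n) (x : 'cV[R]_n) : R :=
  (x^T *m P *m x) 0 0.

Definition sym_posdef {n : nat} (P : 'M[R]_n) : Prop :=
  P^T = P /\ forall x : 'cV[R]_n, x != 0 -> 0 < quadratic_form P x.

Definition hurwitz {n : nat} (A : 'M[R]_n) : Prop :=
  forall z : R[i],
    eigenvalue (map_mx (real_complex R) A) z -> complex.Re z < 0.

(* Only used for symmetric matrices: for n > 0 the set of real eigenvalues is
   then finite and nonempty, and its infimum is the smallest eigenvalue. *)
Definition lambda_min {n : nat} (Q : 'M[R]_n) : R :=
  inf [set a : R | eigenvalue Q a].

(* The library norm on matrices is the max norm. *)
Definition frobenius_norm {p q : nat} (M : 'M[R]_(p, q)) : R :=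
  Num.sqrt (\sum_i \sum_j M i j ^+ 2).

End Matrices.

(* Main.v *)
(* Along the ray t |-> t x, the function phi(t) = h(t x) satisfies phi(0) = 0
   and phi'(0) = 0, because every term of h is a product of two factors
   vanishing at the origin.  Sublevel sets of V_P are star-shaped, so on [0, 1]
   phi''(t) = x^T M(t x) x - 2 x^T Q x <= 2 r |x|^2 - 2 lambda_min(Q) |x|^2
            = - 2 eps |x|^2 < 0,
   and two applications of the mean value theorem give h(x) = phi(1) < 0. *)
Require Import Defs.
From HB Require Import structures.
From mathcomp Require Import all_boot all_order all_algebra.
From mathcomp Require Import boolp classical_sets functions reals topology normedtype derive.
From mathcomp Require Import complex ring lra.

Import Order.TTheory GRing.Theory Num.Theory.
Import numFieldNormedType.Exports.

Local Open Scope classical_set_scope.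
Local Open Scope ring_scope.

Set Implicit Arguments.
Unset Strict Implicit.
Unset Printing Implicit Defensive.

Local Open Scope sesquilinear_scope.

(** * Bounds on quadratic forms: smallest eigenvalue and Frobenius norm *)

Lemma quadratic_form_sum (R : realType) (n : nat) (P : 'M[R]_n) (x : 'cV[R]_n) :
  quadratic_form P x = \sum_i \sum_j P i j * (x i 0 * x j 0).
Proof.
rewrite /quadratic_form -mulmxA mxE; apply: eq_bigr => i _.
rewrite !mxE mulr_sumr; apply: eq_bigr => j _.
by rewrite mulrCA.
Qed.

Lemma sum_sqr_gt0 (R : realDomainType) (n : nat) (x : 'cV[R]_n) :
  x != 0 -> 0 < \sum_i x i 0 ^+ 2.
Proof.
move=> x_neq0; rewrite lt_neqAle sumr_ge0 ?andbT; last by move=> *; exact: sqr_ge0.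
apply: contra x_neq0 => /eqP/esym /psumr_eq0P H; apply/eqP/colP => i.
rewrite mxE; apply/eqP; rewrite -sqrf_eq0; apply/eqP/H => // j _; exact: sqr_ge0.
Qed.

(* The library's spectral theorem is over a closed field, so Q is diagonalized
   over R[i]; its eigenvalues there are real, hence eigenvalues over R. *)
Lemma quadratic_form_ge_eigenvalue (R : realType) (n : nat) (Q : 'M[R]_n) (l : R)
    (x : 'cV[R]_n) :
  Q^T = Q -> (forall a, eigenvalue Q a -> l <= a) ->
  l * \sum_i x i 0 ^+ 2 <= quadratic_form Q x.
Proof.
move=> Q_sym l_le.
pose QC := map_mx (real_complex R) Q; pose y := map_mx (real_complex R) x.
have y_real : y^t* = y^T.
  by apply/matrixP => i j; rewrite !mxE conj_Creal// complex_real.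
have QC_herm : QC \is hermsymmx.
  apply: realsym_hermsym.
    apply/is_hermitianmxP; rewrite expr0 scale1r map_mx_id//.
    by apply/matrixP => i j; rewrite !mxE -{1}Q_sym mxE.
  by apply/mxOverP => i j; rewrite mxE complex_real.
have /orthomx_spectralP QC_eq := hermitian_normalmx QC_herm.
have U_unitary := spectral_unitarymx QC.
have D_real := hermitian_spectral_diag_real QC_herm.
set U := spectralmx QC in QC_eq U_unitary.
set D := spectral_diag QC in QC_eq D_real.
have l_leD i : real_complex R l <= D 0 i.
  have : eigenvalue QC (D 0 i).
    (* Since QC = U^-1 diag(D) U, row i of [U] is a left eigenvector for [D 0 i]. It is nonzero
       because the i-th diagonal entry of U U^* is 1. *)
    apply/eigenvalueP; exists (row i U).
      rewrite -row_mul QC_eq !mulmxA mulmxV ?unitarymx_unit// mul1mx.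
      by rewrite row_mul row_diag_mx -scalemxAl -rowE.
    apply/eqP => rU0; move/unitarymxP/(congr1 (row i)): U_unitary.
    rewrite row_mul rU0 mul0mx => /rowP/(_ i)/eqP.
    by rewrite !mxE eqxx eq_sym oner_eq0.
  have /complex_realP[a ->] := mxOverP D_real 0 i.
  rewrite eigenvalue_root_char -map_char_poly fmorph_root -eigenvalue_root_char.
  by move=> /l_le; rewrite lecR.
(* Coordinates of [x] in the eigenbasis: the form of [Q] and the squared norm become sums of |u_i|^2
   with weights [D 0 i] and 1, so they compare term by term. *)
pose u := U *m y.
have u_eq (E : 'rV[R[i]]_n) :
    (u^t* *m diag_mx E *m u) 0 0 = \sum_i E 0 i * `|u i 0| ^+ 2.
  rewrite -mulmxA mxE; apply: eq_bigr => i _.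
  by rewrite mul_diag_mx !mxE mulrCA normCK; congr (_ * _); exact: mulrC.
have ut_eq : u^t* = y^T *m invmx U.
  by rewrite /u trmx_mul map_mxM y_real invmx_unitary.
have q_eq : real_complex R (quadratic_form Q x) = \sum_i D 0 i * `|u i 0| ^+ 2.
  rewrite -u_eq ut_eq -!mulmxA (mulmxA (diag_mx D)) (mulmxA (invmx U)).
  rewrite (mulmxA (invmx U)) -QC_eq mulmxA.
  by rewrite map_trmx -!map_mxM [RHS]mxE.
have n_eq : real_complex R (\sum_i x i 0 ^+ 2) = \sum_i `|u i 0| ^+ 2.
  transitivity (\sum_i (const_mx 1 : 'rV_n) 0 i * `|u i 0| ^+ 2); last first.
    by apply: eq_bigr => i _; rewrite mxE mul1r.
  rewrite -u_eq diag_const_mx mulmx1 ut_eq mulmxA mulmxKV ?unitarymx_unit//.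
  rewrite mxE rmorph_sum; apply: eq_bigr => i _.
  by rewrite !mxE expr2 rmorphM.
rewrite -lecR q_eq [leLHS](rmorphM (real_complex R))/= n_eq mulr_sumr; apply: ler_sum => i _.
by rewrite ler_wpM2r ?exprn_ge0.
Qed.

Lemma lambda_min_quadratic_form (R : realType) (n : nat) (Q : 'M[R]_n) (x : 'cV[R]_n) :
  sym_posdef Q -> lambda_min Q * \sum_i x i 0 ^+ 2 <= quadratic_form Q x.
Proof.
move=> [Q_sym Q_pos]; apply: quadratic_form_ge_eigenvalue => // a a_eig.
(* An infimum is below the members of its set only if the set is bounded below. The bound 0 works: a
   left eigenvector v for b gives 0 < v Q v^T = b |v|^2. *)
apply: ge_inf => //; exists 0 => b /eigenvalueP[v vQ v_neq0].
have vT_neq0 : v^T != 0 by rewrite -[0]trmx0 (inj_eq trmx_inj).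
have := Q_pos _ vT_neq0; rewrite /quadratic_form trmxK vQ -scalemxAl mxE.
have := sum_sqr_gt0 vT_neq0.
have -> : (v *m v^T) 0 0 = \sum_i v^T i 0 ^+ 2.
  by rewrite mxE; apply: eq_bigr => i _; rewrite !mxE expr2.
by move=> s_gt0; rewrite pmulr_lgt0// => /ltW.
Qed.

Lemma quadratic_form_le_frobenius (R : realType) (n : nat) (M : 'M[R]_n) (b : R)
    (x : 'cV[R]_n) :
  0 < b -> frobenius_norm M <= b -> quadratic_form M x <= b * \sum_i x i 0 ^+ 2.
Proof.
move=> b_gt0 M_le; have [->|x_neq0] := eqVneq x 0.
  rewrite /quadratic_form mulmx0 mxE; apply: mulr_ge0; first exact: ltW.
  by apply: sumr_ge0 => i _; exact: sqr_ge0.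
set N := \sum_i _; have N_gt0 : 0 < N := sum_sqr_gt0 x_neq0.
have M2_le : \sum_i \sum_j M i j ^+ 2 <= b ^+ 2.
  have M2_ge0 : 0 <= \sum_i \sum_j M i j ^+ 2.
    by do 2!(apply: sumr_ge0 => ? _); exact: sqr_ge0.
  rewrite -[leLHS]sqr_sqrtr// lerXn2r ?nnegrE ?sqrtr_ge0//; exact: ltW.
have N2_eq : \sum_i \sum_j (x i 0 * x j 0) ^+ 2 = N ^+ 2.
  rewrite expr2 mulr_suml; apply: eq_bigr => i _; rewrite mulr_sumr.
  by apply: eq_bigr => j _; rewrite exprMn.
clearbody N.
(* Cauchy-Schwarz for M and x x^T, whose Frobenius norm is N. *)
have : 0 <= \sum_i \sum_j (N * M i j - b * (x i 0 * x j 0)) ^+ 2.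
  by do 2!(apply: sumr_ge0 => ? _); exact: sqr_ge0.
have -> : \sum_i \sum_j (N * M i j - b * (x i 0 * x j 0)) ^+ 2 =
    N ^+ 2 * (\sum_i \sum_j M i j ^+ 2) + b ^+ 2 * N ^+ 2 -
    2 * N * b * quadratic_form M x.
  rewrite quadratic_form_sum -[X in b ^+ 2 * X]N2_eq !mulr_sumr -big_split -sumrB/=.
  apply: eq_bigr => i _; rewrite !mulr_sumr -big_split -sumrB/=.
  by apply: eq_bigr => j _; ring.
have : N ^+ 2 * (\sum_i \sum_j M i j ^+ 2) <= N ^+ 2 * b ^+ 2.
  by rewrite ler_wpM2l ?sqr_ge0.
(* The expanded square gives 2 N b q <= N^2 |M|^2 + b^2 N^2 <= 2 N^2 b^2, and dividing by 2 N b > 0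
   leaves q <= b N. *)
move=> le1 ge0; have bN_gt0 : 0 < 2 * N * b by rewrite !mulr_gt0.
rewrite -(ler_pM2l bN_gt0); move: le1 ge0; set F := \sum_i _; set q := quadratic_form _ _.
lra.
Qed.

(** * Partial derivatives and twice differentiable functions *)

(** The regularity carried from the coefficients to the generator: it is stable under sums and
    products, and it lets a directional derivative be differentiated again along a ray. *)
Definition twice_differentiable (R : realType) (n : nat) (g : 'cV[R]_n -> R) :=
  (forall x, differentiable g x) /\ forall j x, differentiable (partial j g) x.

Lemma C2_twice_differentiable (R : realType) (n : nat) (g : 'cV[R]_n -> R) :
  C2 g -> twice_differentiable g.
Proof.
move=> [dg d2g _]; split=> // j x.
rewrite (_ : partial j g = (fun v : 'rV[R]_n => v 0 j) \o gradient g); last first.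
  by apply/funext => y /=; rewrite mxE.
exact: differentiable_comp (d2g x) (differentiable_coord _ _ _).
Qed.

Lemma derive_partial (R : realType) (n : nat) (g : 'cV[R]_n -> R) (x v : 'cV[R]_n) :
  differentiable g x -> 'D_v g x = \sum_j v j 0 * partial j g x.
Proof.
move=> dg; rewrite deriveE// {1}[v]matrix_sum_delta linear_sum/=.
apply: eq_bigr => j _; rewrite big_ord1 linearZ/=; congr (_ * _).
by rewrite /partial deriveE.
Qed.

Lemma partial_cst (R : realType) (n : nat) (a : R) (j : 'I_n) :
  partial j (cst a) = cst 0 :> ('cV[R]_n -> R).
Proof. by apply/funext => x; exact: derive_cst. Qed.

Lemma partial_coord (R : realType) (n : nat) (i j : 'I_n) :
  partial j (fun x : 'cV[R]_n => x i 0) = cst (i == j)%:R.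
Proof.
apply/funext => x; rewrite /partial.
(* Derivatives of matrix-valued maps are taken entrywise, and the derivative of the identity is the
   direction itself, here [delta_mx j 0]. *)
have := @derive_mx R _ _ _ id x (delta_mx j 0) (@derivable_id _ _ _ _).
rewrite derive_id => /matrixP/(_ i 0); rewrite !mxE eqxx andbT => <-.
by [].
Qed.

Lemma partialD (R : realType) (n : nat) (g k : 'cV[R]_n -> R) (j : 'I_n) :
  (forall x, differentiable g x) -> (forall x, differentiable k x) ->
  partial j (g + k) = partial j g + partial j k.
Proof.
by move=> dg dk; apply/funext => x; apply: deriveD; exact: diff_derivable.
Qed.

Lemma partialM (R : realType) (n : nat) (g k : 'cV[R]_n -> R) (j : 'I_n) :
  (forall x, differentiable g x) -> (forall x, differentiable k x) ->
  partial j (g * k) = g * partial j k + k * partial j g.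
Proof.
by move=> dg dk; apply/funext => x; apply: deriveM; exact: diff_derivable.
Qed.

Lemma twice_differentiable_cst (R : realType) (n : nat) (a : R) :
  twice_differentiable (cst a : 'cV[R]_n -> R).
Proof.
split=> [x|j x]; first exact: differentiable_cst.
by rewrite partial_cst; exact: differentiable_cst.
Qed.

Lemma twice_differentiable_coord (R : realType) (n : nat) (i : 'I_n) :
  twice_differentiable (fun x : 'cV[R]_n => x i 0).
Proof.
split=> [x|j x]; first exact: differentiable_coord.
by rewrite partial_coord; exact: differentiable_cst.
Qed.

Lemma twice_differentiableD (R : realType) (n : nat) (g k : 'cV[R]_n -> R) :
  twice_differentiable g -> twice_differentiable k ->
  twice_differentiable (g + k).
Proof.
move=> [dg d2g] [dk d2k]; split=> [x|j x]; first exact: differentiableD.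
rewrite partialD; [|exact: dg|exact: dk].
exact: differentiableD (d2g j x) (d2k j x).
Qed.

Lemma twice_differentiableM (R : realType) (n : nat) (g k : 'cV[R]_n -> R) :
  twice_differentiable g -> twice_differentiable k ->
  twice_differentiable (g * k).
Proof.
move=> [dg d2g] [dk d2k]; split=> [x|j x]; first exact: differentiableM.
rewrite partialM; [|exact: dg|exact: dk].
exact: differentiableD (differentiableM (dg x) (d2k j x))
  (differentiableM (dk x) (d2g j x)).
Qed.

(** * Functions vanishing to first order at the origin, and their sign along rays *)

(** Provides phi(0) = phi'(0) = 0 on every ray at once, in a form that can be checked summand by
    summand. *)
Definition flat_at_0 (R : realType) (n : nat) (g : 'cV[R]_n -> R) :=
  [/\ twice_differentiable g, g 0 = 0 & forall j, partial j g 0 = 0].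

Lemma flat_at_0_sum (R : realType) (n : nat) (I : Type) (s : seq I)
    (g : I -> 'cV[R]_n -> R) :
  (forall i, flat_at_0 (g i)) -> flat_at_0 (fun x => \sum_(i <- s) g i x).
Proof.
move=> flat; rewrite (_ : (fun x => _) = \sum_(i <- s) g i); last first.
  by apply/funext => x; rewrite fct_sumE.
elim/big_rec: _ => [|i k _ [d2k k0 pk0]].
  split=> [|//|j]; first exact: twice_differentiable_cst.
  by rewrite -[X in partial _ X]/(cst 0) partial_cst.
have [d2g g0 pg0] := flat i; split; first exact: twice_differentiableD.
- by rewrite -[LHS]/(g i 0 + k 0) g0 k0 addr0.
- move=> j; rewrite partialD; [|exact: d2g.1|exact: d2k.1].
  by rewrite -[LHS]/(partial j (g i) 0 + partial j k 0) pg0 pk0 addr0.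
Qed.

(** By the Leibniz rule, each term of a partial derivative of the product keeps one undifferentiated
    factor, which vanishes at 0. *)
Lemma flat_at_0M (R : realType) (n : nat) (g k : 'cV[R]_n -> R) :
  twice_differentiable g -> twice_differentiable k -> g 0 = 0 -> k 0 = 0 ->
  flat_at_0 (fun x => g x * k x).
Proof.
move=> d2g d2k g0 k0; split; first exact: (twice_differentiableM d2g d2k).
- by rewrite g0 mul0r.
- move=> j; rewrite -[fun x => _]/(g * k) partialM; [|exact: d2g.1|exact: d2k.1].
  by rewrite -[LHS]/(g 0 * partial j k 0 + k 0 * partial j g 0) g0 k0 !mul0r addr0.
Qed.

(** As (h + t) x = h x + t x, the difference quotient along the ray is literally that of [g] at
    [t *: x] in direction [x]. *)
Lemma is_derive_ray (R : realType) (n : nat) (g : 'cV[R]_n -> R) (x : 'cV[R]_n) (t : R) :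
  derivable g (t *: x) x -> is_derive t 1 (fun s : R => g (s *: x)) ('D_x g (t *: x)).
Proof.
move=> dg.
have quotE : (fun h : R => h^-1 *: (((fun s : R => g (s *: x)) \o shift t) (h *: 1) -
      g (t *: x))) =
    (fun h : R => h^-1 *: ((g \o shift (t *: x)) (h *: x) - g (t *: x))).
  by apply/funext => h /=; rewrite scalerDl [h *: 1]mulr1.
by apply: DeriveDef; rewrite /derivable /derive quotE.
Qed.

Lemma flat_at_0_lt0 (R : realType) (n : nat) (g : 'cV[R]_n -> R) (x : 'cV[R]_n) :
  flat_at_0 g ->
  (forall t : R, 0 < t < 1 -> quadratic_form (hessian g (t *: x)) x < 0) -> g x < 0.
Proof.
move=> [[dg d2g] g0 pg0] hess_lt0.
pose phi := fun t : R => g (t *: x); pose psi : R -> R := fun t : R => 'D_x g (t *: x).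
have dphi (t : R) : is_derive t 1 phi (psi t) by exact/is_derive_ray/diff_derivable.
have dpsi (t : R) : is_derive t 1 psi (quadratic_form (hessian g (t *: x)) x).
  (* Expanding the directional derivative in partials with constant weights [x j 0] allows termwise
     differentiation, which produces the Hessian. *)
  have -> : psi = \sum_j (cst (x j 0) * fun t => partial j g (t *: x)).
    apply/funext => s; rewrite fct_sumE /psi derive_partial//.
  have -> : quadratic_form (hessian g (t *: x)) x =
      \sum_j (x j 0 *: 'D_x (partial j g) (t *: x) + partial j g (t *: x) *: 0).
    rewrite quadratic_form_sum exchange_big/=; apply: eq_bigr => j _.
    rewrite scaler0 addr0 derive_partial// scaler_sumr; apply: eq_bigr => i _.
    by rewrite mxE [LHS]mulrC -mulrA mulrCA.
  by apply: is_derive_sum => j; apply: is_deriveM; exact/is_derive_ray/diff_derivable.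
have cont (u du : R -> R) : (forall t : R, is_derive t 1 u (du t)) -> continuous u.
  move=> du_ t; apply: differentiable_continuous; apply/derivable1_diffP.
  exact: (@ex_derive _ _ _ _ _ _ _ (du_ t)).
(* On [0, 1] this gives g x = phi(1) = psi(a). *)
have [a /[!in_itv]/= /andP[a_gt0 a_lt1]] := MVT ltr01 (fun t _ => dphi t)
  (continuous_subspaceT (cont _ _ dphi)).
rewrite subr0 mulr1 {1 2}/phi scale1r scale0r g0 subr0 => ->.
(* On [0, a] this gives psi(a) = a phi''(b) with 0 < b < a < 1, so the Hessian hypothesis applies at
   b. *)
have [b /[!in_itv]/= /andP[b_gt0 b_lt]] := MVT a_gt0 (fun t _ => dpsi t)
  (continuous_subspaceT (cont _ _ dpsi)).
have -> : psi 0 = 0.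
  by rewrite /psi scale0r derive_partial// big1// => j _; rewrite pg0 mulr0.
rewrite !subr0 => ->; rewrite pmulr_llt0//; apply: hess_lt0.
by rewrite b_gt0 (lt_trans b_lt).
Qed.

(** * Derivatives of finite sums, linear forms and quadratic forms *)

Lemma partial_sum (R : realType) (n p : nat) (g : 'I_p -> 'cV[R]_n -> R) (j : 'I_n) :
  (forall i x, differentiable (g i) x) ->
  partial j (fun x => \sum_i g i x) = fun x => \sum_i partial j (g i) x.
Proof.
move=> dg; apply/funext => x; rewrite /partial.
rewrite (_ : (fun x => \sum_i g i x) = \sum_i g i); last first.
  by apply/funext => y; rewrite fct_sumE.
by rewrite derive_sum// => i; exact: diff_derivable.
Qed.

Lemma twice_differentiable_sum (R : realType) (n p : nat) (g : 'I_p -> 'cV[R]_n -> R) :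
  (forall i, twice_differentiable (g i)) ->
  twice_differentiable (fun x => \sum_i g i x).
Proof.
move=> d2g; rewrite (_ : (fun x => _) = \sum_i g i); last first.
  by apply/funext => y; rewrite fct_sumE.
elim/big_ind: _ => //; first exact: twice_differentiable_cst.
exact: twice_differentiableD.
Qed.

Lemma twice_differentiable_linear_form (R : realType) (n : nat) (a : 'I_n -> R) :
  twice_differentiable (fun x : 'cV[R]_n => \sum_i a i * x i 0).
Proof.
apply: twice_differentiable_sum => i.
exact: (twice_differentiableM (twice_differentiable_cst n (a i))
  (twice_differentiable_coord R i)).
Qed.

Lemma partial_linear_form (R : realType) (n : nat) (a : 'I_n -> R) (j : 'I_n) :
  partial j (fun x => \sum_i a i * x i 0) = cst (a j).
Proof.
have dcst b x : differentiable (cst b : 'cV[R]_n -> R) x.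
  exact: differentiable_cst.
have dcoord i x : differentiable (fun y : 'cV[R]_n => y i 0) x.
  exact: differentiable_coord.
rewrite partial_sum; last by move=> i x; exact: differentiableM (dcst _ _) (dcoord _ _).
apply/funext => x; rewrite (bigD1 j)//= big1 => [|i i_neq_j].
  rewrite -[fun y => _]/(cst (a j) * (fun y : 'cV[R]_n => y j 0)) partialM//.
  rewrite partial_cst partial_coord eqxx addr0.
  by rewrite -[LHS]/(a j * 1 + x j 0 * 0) mulr1 mulr0 addr0.
rewrite -[fun y => _]/(cst (a i) * (fun y : 'cV[R]_n => y i 0)) partialM//.
rewrite partial_cst partial_coord (negPf i_neq_j).
by rewrite -[LHS]/(a i * 0 + x i 0 * 0) !mulr0 addr0.
Qed.

(** With x^T P x written as the sum of the products x_i (P x)_i, the product rule gives (P^T x)_k +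
    (P x)_k, and symmetry merges the two. *)
Lemma partial_quadratic_form (R : realType) (n : nat) (P : 'M[R]_n) (k : 'I_n) :
  P^T = P ->
  partial k (quadratic_form P) = fun x => \sum_i (2 * P k i) * x i 0.
Proof.
move=> P_sym.
have P_symE i j : P i j = P j i by rewrite -{1}P_sym mxE.
pose X i := fun x : 'cV[R]_n => x i 0.
pose L i := fun x : 'cV[R]_n => \sum_j P i j * x j 0.
have dX i x : differentiable (X i) x by exact: differentiable_coord.
have dL i x : differentiable (L i) x by exact: (twice_differentiable_linear_form _).1.
rewrite (_ : quadratic_form P = fun x => \sum_i (X i * L i) x); last first.
  apply/funext => x; rewrite quadratic_form_sum; apply: eq_bigr => i _.
  rewrite -[RHS]/(x i 0 * (\sum_j P i j * x j 0)) mulr_sumr.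
  by apply: eq_bigr => j _; rewrite mulrCA.
rewrite partial_sum => [|i x]; last exact: differentiableM.
apply/funext => x.
transitivity (\sum_i (x i 0 * P i k + L i x * (i == k)%:R)).
  by apply: eq_bigr => i _; rewrite partialM// partial_linear_form partial_coord.
rewrite big_split/= [X in _ + X](bigD1 k)//= eqxx mulr1.
rewrite [X in _ + (_ + X)]big1 => [|i /negPf->]; last by rewrite mulr0.
rewrite addr0 /L -big_split/=.
by apply: eq_bigr => i _; rewrite (P_symE i k); ring.
Qed.

Lemma hessian_quadratic_form (R : realType) (n : nat) (P : 'M[R]_n) (x : 'cV[R]_n) :
  P^T = P -> hessian (quadratic_form P) x = 2 *: P.
Proof.
move=> P_sym; apply/matrixP => i j.
by rewrite !mxE partial_quadratic_form// partial_linear_form -{1}P_sym mxE.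
Qed.

(** * The generator applied to a quadratic form *)

(** Drift terms ([inl]) and diffusion terms ([inr]) are indexed by one sum type, so that the
    generator is a single finite sum of products to which [flat_at_0_sum] applies. *)
Lemma generator_quadratic_form (R : realType) (n m : nat) (f : 'cV[R]_n -> 'cV[R]_n)
    (sigma : 'cV[R]_n -> 'M[R]_(n, m)) (P : 'M[R]_n) (x : 'cV[R]_n) : P^T = P ->
  generator f sigma (quadratic_form P) x =
  \sum_(z : 'I_n + 'I_m * 'I_n)
    match z with
    | inl i => (\sum_j (2 * P i j) * x j 0) * f x i 0
    | inr ki => (\sum_j P ki.2 j * sigma x j ki.1) * sigma x ki.2 ki.1
    end.
Proof.
move=> P_sym; rewrite /generator hessian_quadratic_form// big_sumType/=.
congr (_ + _).
  by rewrite mxE; apply: eq_bigr => i _; rewrite mxE partial_quadratic_form.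
(* The factor 1/2 of the generator cancels the 2 in the Hessian 2 P, leaving the trace of sigma^T P
   sigma. *)
rewrite -scalemxAr -scalemxAl linearZ/= mulrA mulVf ?pnatr_eq0// mul1r.
rewrite -(pair_bigA _ (fun k i => (\sum_j P i j * sigma x j k) * sigma x i k))/=.
apply: eq_bigr => k _; rewrite mxE; apply: eq_bigr => i _; congr (_ * _).
by rewrite mxE; apply: eq_bigr => j _; rewrite !mxE mulrC -{1}P_sym mxE.
Qed.

(** In a drift term one factor vanishes at 0 by linearity and the other by [f 0 = 0]; in a diffusion
    term both vanish by [sigma 0 = 0]. *)
Lemma flat_at_0_generator (R : realType) (n m : nat) (f : 'cV[R]_n -> 'cV[R]_n)
    (sigma : 'cV[R]_n -> 'M[R]_(n, m)) (P : 'M[R]_n) :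
  C2_mx f -> C2_mx sigma -> f 0 = 0 -> sigma 0 = 0 -> P^T = P ->
  flat_at_0 (generator f sigma (quadratic_form P)).
Proof.
move=> f_C2 sigma_C2 f0 sigma0 P_sym.
rewrite (funext (fun x => generator_quadratic_form f sigma x P_sym)).
apply: flat_at_0_sum => -[i|[k i]]/=.
  apply: flat_at_0M; last by rewrite f0 mxE.
  - exact: twice_differentiable_linear_form.
  - exact/C2_twice_differentiable/f_C2.
  - by rewrite big1// => j _; rewrite mxE mulr0.
have d2sigma j : twice_differentiable (fun x => sigma x j k).
  exact/C2_twice_differentiable/sigma_C2.
apply: flat_at_0M => //; last by rewrite sigma0 mxE.
  apply: twice_differentiable_sum => j.
  exact: (twice_differentiableM (twice_differentiable_cst n (P i j)) (d2sigma j)).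
by rewrite big1// => j _; rewrite sigma0 mxE mulr0.
Qed.

Unset Implicit Arguments.

(** * Combining the bounds on the sublevel set *)

Theorem proposition11 (R : realType) (n m : nat)
    (f : 'cV[R]_n -> 'cV[R]_n) (sigma : 'cV[R]_n -> 'M[R]_(n, m))
    (f_C2 : C2_mx f) (sigma_C2 : C2_mx sigma)
    (f0 : f 0 = 0) (sigma0 : sigma 0 = 0)
    (A : 'M[R]_n) (A_def : A = jacobian_mx f 0)
    (S : 'I_m -> 'M[R]_n)
    (S_def : forall k, S k = jacobian_mx (fun x => col k (sigma x)) 0)
    (A_hurwitz : hurwitz A)
    (Q : 'M[R]_n) (Q_posdef : sym_posdef Q)
    (P : 'M[R]_n) (P_posdef : sym_posdef P)
    (lyapunov : P *m A + A^T *m P + \sum_(i < m) (S i)^T *m P *m S i = - Q)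
    (V_P : 'cV[R]_n -> R) (V_P_def : V_P = quadratic_form P)
    (h : 'cV[R]_n -> R) (h_def : h = generator f sigma V_P)
    (M : 'cV[R]_n -> 'M[R]_n)
    (M_def : M = fun x => hessian h x + 2 *: Q)
    (eps : R) (eps_gt0 : 0 < eps)
    (r : R) (r_def : r = lambda_min Q - eps) (r_gt0 : 0 < r)
    (c : R) (c_gt0 : 0 < c)
    (M_le : forall x : 'cV[R]_n, V_P x <= c -> frobenius_norm (M x) <= 2 * r) :
  forall x : 'cV[R]_n, V_P x <= c -> x != 0 -> generator f sigma V_P x < 0.
Proof.
move=> x Vx_le x_neq0; have [P_sym P_pos] := P_posdef.
rewrite -h_def; apply: flat_at_0_lt0 => [|t /andP[t_gt0 t_lt1]].
  by rewrite h_def V_P_def; exact: flat_at_0_generator.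
(* [V_P] is homogeneous of degree 2 and positive at [x], so scaling by t in (0, 1) does not increase
   it. *)
have Vtx_le : V_P (t *: x) <= c.
  have Vx_gt0 : 0 < V_P x by rewrite V_P_def; exact: P_pos.
  have -> : V_P (t *: x) = t ^+ 2 * V_P x.
    rewrite V_P_def !quadratic_form_sum mulr_sumr; apply: eq_bigr => i _.
    by rewrite mulr_sumr; apply: eq_bigr => j _; rewrite !mxE; ring.
  apply: le_trans Vx_le; rewrite ger_pMl// expr_le1//; exact: ltW.
(* Positivity of [r] makes 2 r an admissible bound in the Cauchy-Schwarz estimate, which divides by
   it. *)
have r2_gt0 : 0 < 2 * r by rewrite mulr_gt0.
have := quadratic_form_le_frobenius x r2_gt0 (M_le _ Vtx_le).
have -> : quadratic_form (M (t *: x)) x =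
    quadratic_form (hessian h (t *: x)) x + 2 * quadratic_form Q x.
  rewrite M_def /quadratic_form mulmxDr mulmxDl mxE -scalemxAr -scalemxAl.
  by rewrite [X in _ + X]mxE.
have := lambda_min_quadratic_form x Q_posdef.
have := mulr_gt0 eps_gt0 (sum_sqr_gt0 x_neq0).
rewrite r_def; lra.
Qed.
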